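(* For all $\lambda,\mu\in\mathbb F$, $(V,\psi_{\lambda\mu})$ is a reducible module of the Lie algebra $\mathrm{ad}(A_\omega^\delta)$ with submodules $U(\alpha)=\sum_{m\in\mathbb Z}\mathbb F v_{\alpha+m}$, $\alpha\in\mathbb F$, and: 1) if $\mu=0$, then $\mathbb F v_{-\lambda}$ is a trivial submodule; if $\mu=1$, then $U'(-\lambda)=\sum_{m\in\mathbb Z,\ m\neq0}\mathbb F v_{-\lambda+m}$ is irreducible; 2) $U(-\lambda)=\sum_{m\in\mathbb Z}\mathbb F v_{-\lambda+m}$ is irreducible if and only if $\mu\neq1$ and $\mu\neq0$.
   Context: $\mathbb F$ is a field of characteristic zero (so $\mathbb Z\subset\mathbb F$); all vector spaces and algebras are over $\mathbb F$. $A_\omega^\delta$ is the (simple) 3-Lie algebra with basis $\{L_r,M_r\mid r\in\mathbb Z\}$ and skew-symmetric trilinear bracket determined by $[L_r,L_s,M_t]=(s-r)L_{r+s-t}$, $[L_r,M_s,M_t]=(t-s)M_{s+t-r}$ for $r,s,t\in\mathbb Z$, all other brackets of basis elements (i.e. $[L_r,L_s,L_t]$ and $[M_r,M_s,M_t]$) being zero. For $x,y\in A_\omega^\delta$, $\mathrm{ad}(x,y)(z)=[x,y,z]$; the inner derivation algebra $\mathrm{ad}(A_\omega^\delta)$ is the Lie algebra (under the commutator) of all linear combinations of the maps $\mathrm{ad}(x,y)$. It is known that $\mathrm{ad}(A_\omega^\delta)$ has a basis $\{p_r,q_r,x_r,z_r\mid r\in\mathbb Z\}$, where for $r\neq0$: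 $p_r=\frac12(\mathrm{ad}(L_0,M_{-r})+\mathrm{ad}(L_r,M_0))$, $q_r=\frac1r(\mathrm{ad}(L_0,M_{-r})-\mathrm{ad}(L_r,M_0))$, $x_r=\frac1r\mathrm{ad}(L_r,L_0)$, $z_r=\frac1{-r}\mathrm{ad}(M_{-r},M_0)$; and $p_0=\mathrm{ad}(L_0,M_0)$, $q_0=\mathrm{ad}(L_0,M_0)-\mathrm{ad}(L_1,M_1)$, $x_0=\frac12\mathrm{ad}(L_1,L_{-1})$, $z_0=\frac12\mathrm{ad}(M_1,M_{-1})$. The Lie brackets are, for $r,s\in\mathbb Z$: $[p_r,p_s]=(r-s)p_{r+s}$, $[p_r,q_s]=-sq_{r+s}$, $[p_r,x_s]=-sx_{r+s}$, $[p_r,z_s]=-sz_{r+s}$, $[q_r,x_s]=-2x_{r+s}$, $[q_r,z_s]=2z_{r+s}$, $[z_r,x_s]=q_{r+s}$, the others being zero. $V=\sum_{\alpha\in\mathbb F}\mathbb F v_\alpha$ is the vector space with basis $\{v_\alpha\mid\alpha\in\mathbb F\}$. For $\lambda,\mu\in\mathbb F$, the linear map $\psi_{\lambda\mu}:\mathrm{ad}(A_\omega^\delta)\to gl(V)$ is defined, for $r\in\mathbb Z$, $\alpha\in\mathbb F$, by $\psi_{\lambda\mu}(p_r)v_\alpha=(\lambda+\alpha-r\mu)v_{\alpha-r}$ and $\psi_{\lambda\mu}(q_r)v_\alpha=\psi_{\lambda\mu}(x_r)v_\alpha=\psi_{\lambda\mu}(z_r)v_\alpha=0$. A trivial submodule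 is one on which the Lie algebra acts as zero; a module is irreducible if it has no submodules other than $0$ and itself, and reducible otherwise. *)

(* Defs.v *)
From HB Require Import structures.
From mathcomp Require Import all_boot all_order all_algebra.
From mathcomp Require Import finmap.
From mathcomp Require Import boolp classical_sets functions.
From mathcomp.multinomials Require Import monalg.
From mathcomp Require Import ring.

Set Implicit Arguments.
Unset Strict Implicit.
Unset Printing Implicit Defensive.

Import GRing.Theory.

Local Open Scope classical_set_scope.
Local Open Scope ring_scope.

HB.mixin Record Lmodule_isLie (F : fieldType) L of GRing.Lmodule F L := {
  lie : L -> L -> L;
  lie_linearl : forall y, linear (lie ^~ y);
  lie_linearr : forall x, linear (lie x);
  liexx : forall x, lie x x = 0;
  lie_jacobi : forall x y z,
    lie x (lie y z) + lie y (lie z x) + lie z (lie x y) = 0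
}.

#[short(type="lieType")]
HB.structure Definition LieAlgebra (F : fieldType) :=
  { L of GRing.Lmodule F L & Lmodule_isLie F L }.

HB.mixin Record Lmodule_isLie3 (F : fieldType) A of GRing.Lmodule F A := {
  br : A -> A -> A -> A;
  br_linear1 : forall y z, linear (fun x => br x y z);
  br_linear2 : forall x z, linear (fun y => br x y z);
  br_linear3 : forall x y, linear (fun z => br x y z);
  br_skew12 : forall x y z, br y x z = - br x y z;
  br_skew23 : forall x y z, br x z y = - br x y z;
  br_filippov : forall x y a b c,
    br x y (br a b c) = br (br x y a) b c + br a (br x y b) c + br a b (br x y c)
}.

#[short(type="lie3Type")]
HB.structure Definition Lie3Algebra (F : fieldType) :=
  { A of GRing.Lmodule F A & Lmodule_isLie3 F A }.

Section Span.
Context {F : fieldType} {V : lmodType F}.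

Definition lspan (S : set V) : set V :=
  [set v | exists2 s : seq (F * V),
    (forall t, t \in s -> S t.2) & v = \sum_(t <- s) t.1 *: t.2].

Definition subspace (W : set V) : Prop :=
  W 0 /\ forall (a : F) u v, W u -> W v -> W (a *: u + v).

Lemma lspan_subspace S : subspace (lspan S).
Proof.
split; first by exists [::] => //; rewrite big_nil.
move=> a _ _ [s sS ->] [t tS ->].
exists ([seq (a * x.1, x.2) | x <- s] ++ t).
  move=> x; rewrite mem_cat => /orP[/mapP[y ys ->]|/tS//]; exact: sS ys.
rewrite big_cat big_map scaler_sumr; congr (_ + _).
by apply: eq_bigr => x _; rewrite scalerA.
Qed.

Lemma sub_lspan S : S `<=` lspan S.
Proof.
move=> v Sv; exists [:: (1, v)]; last by rewrite big_seq1 scale1r.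
by move=> t; rewrite inE => /eqP ->.
Qed.

Lemma lspan_ind (S P : set V) : subspace P -> S `<=` P -> lspan S `<=` P.
Proof.
move=> [P0 PD] SP _ [s sS ->]; elim: s sS => [|t s IHs] sS.
  by rewrite big_nil.
rewrite big_cons; apply: PD; first by apply/SP/sS; rewrite inE eqxx.
by apply: IHs => x xs; apply: sS; rewrite inE xs orbT.
Qed.

End Span.

Section GeneralLinear.
Context {F : fieldType} (V : lmodType F).

Definition gl_pred : {pred V -> V} := fun f => `[< linear f >].

Lemma gl_submod_closed : submod_closed gl_pred.
Proof.
split; first by apply/asboolP => a u v /=; rewrite scaler0 addr0.
move=> a f g /asboolP fl /asboolP gl; apply/asboolP => b u v.
have E w : (a *: f + g) w = a *: f w + g w by [].
by rewrite !E fl gl !scalerDr !scalerA [b * a]mulrC addrACA.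
Qed.

HB.instance Definition _ :=
  GRing.isSubmodClosed.Build F (V -> V) gl_pred gl_submod_closed.

Record gl := Gl { gl_val :> V -> V; gl_valP : gl_val \in gl_pred }.

HB.instance Definition _ := [isSub for gl_val].
HB.instance Definition _ := [Choice of gl by <:].
HB.instance Definition _ := [SubChoice_isSubLmodule of gl by <:].

Lemma gl_linear (f : gl) : linear f.
Proof. by case: f => f /= /asboolP. Qed.

HB.instance Definition _ (f : gl) :=
  GRing.isLinear.Build F V V *:%R (gl_val f) (gl_linear f).

Lemma commutator_subproof (f g : gl) :
  (fun v => f (g v) - g (f v)) \in gl_pred.
Proof.
apply/asboolP => a u v; by rewrite !linearP /= scalerDr addrACA.
Qed.

Definition commutator (f g : gl) : gl := Gl (commutator_subproof f g).

Lemma commE f g v : commutator f g v = f (g v) - g (f v). Proof. by []. Qed.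

Lemma glP (f g : gl) : f =1 g -> f = g.
Proof. by move=> fg; apply/val_inj/funext. Qed.

Lemma gl0E v : (0 : gl) v = 0. Proof. by []. Qed.
Lemma glDE (f g : gl) v : (f + g) v = f v + g v. Proof. by []. Qed.
Lemma glNE (f : gl) v : (- f) v = - f v. Proof. by []. Qed.
Lemma glZE a (f : gl) v : (a *: f) v = a *: f v. Proof. by []. Qed.

Lemma commutator_linearl g : linear (commutator^~ g).
Proof.
suff H a (f h : gl) :
    commutator (a *: f + h) g = a *: commutator f g + commutator h g.
  by move=> a f h; exact: H.
apply: glP => v; rewrite glDE glZE !commE !glDE !glZE linearP /=.
by rewrite scalerBr opprD addrACA.
Qed.

Lemma commutator_linearr f : linear (commutator f).
Proof.
suff H a (g h : gl) :
    commutator f (a *: g + h) = a *: commutator f g + commutator f h.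
  by move=> a g h; exact: H.
apply: glP => v; rewrite glDE glZE !commE !glDE !glZE linearP /=.
by rewrite scalerBr opprD addrACA.
Qed.

Lemma commutatorxx f : commutator f f = 0.
Proof. by apply: glP => v; rewrite commE subrr. Qed.

Lemma commutator_jacobi f g h : commutator f (commutator g h) +
  commutator g (commutator h f) + commutator h (commutator f g) = 0.
Proof.
apply: glP => v; rewrite !glDE gl0E !commE !linearB /= !opprK !addrA.
set a := f (g (h v)); set b := f (h (g v)); set c := g (h (f v)).
set d := g (f (h v)); set e := h (f (g v)); set k := h (g (f v)).
rewrite (ACl ((1*11)*(2*8)*(3*5)*(4*10)*(6*12)*(7*9))) /=.
by rewrite !subrr !addNr !addr0.
Qed.

HB.instance Definition _ := Lmodule_isLie.Build F gl
  commutator_linearl commutator_linearr commutatorxx commutator_jacobi.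

End GeneralLinear.

Arguments gl_pred {F} V f.

Lemma linear_at0 {F : fieldType} {U V : lmodType F} (f : U -> V) :
  linear f -> f 0 = 0.
Proof. by move=> /(_ (-1) 0 0); rewrite scaler0 addr0 scaleN1r addNr. Qed.

Section Inner.
Context {F : fieldType} (A : lie3Type F).

Lemma ad_subproof (x y : A) : br x y \in gl_pred A.
Proof. by apply/asboolP; exact: br_linear3. Qed.

Definition ad (x y : A) : gl A := Gl (ad_subproof x y).

Definition inner_pred : {pred gl A} :=
  fun D => `[< lspan (range (fun t : A * A => ad t.1 t.2)) D >].

Lemma inner_submod_closed : submod_closed inner_pred.
Proof.
have [P0 PD] := lspan_subspace (range (fun t : A * A => ad t.1 t.2)).
split; first exact/asboolP.
by move=> a u v /asboolP Pu /asboolP Pv; apply/asboolP/PD.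
Qed.

HB.instance Definition _ :=
  GRing.isSubmodClosed.Build F (gl A) inner_pred inner_submod_closed.

Record inner := Inner { inner_val :> gl A; inner_valP : inner_val \in inner_pred }.

HB.instance Definition _ := [isSub for inner_val].
HB.instance Definition _ := [Choice of inner by <:].
HB.instance Definition _ := [SubChoice_isSubLmodule of inner by <:].

Lemma inner0E x : (0 : inner) x = 0. Proof. by []. Qed.
Lemma innerDE (D E : inner) x : (D + E) x = D x + E x. Proof. by []. Qed.
Lemma innerNE (D : inner) x : (- D) x = - D x. Proof. by []. Qed.
Lemma innerZE a (D : inner) x : (a *: D) x = a *: D x. Proof. by []. Qed.

Lemma inner_ad_subproof x y : ad x y \in inner_pred.
Proof. by apply/asboolP/sub_lspan; exists (x, y). Qed.

Definition inner_ad x y : inner := Inner (inner_ad_subproof x y).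

Lemma lie_ad (D : gl A) x y :
  (forall a b c, D (br a b c) = br (D a) b c + br a (D b) c + br a b (D c)) ->
  lie D (ad x y) = ad (D x) y + ad x (D y).
Proof.
move=> derD; apply: glP => z; rewrite glDE commE /= derD.
by rewrite addrK.
Qed.

Lemma innerP (P : set inner) : subspace P -> (forall x y, P (inner_ad x y)) ->
  forall D, P D.
Proof.
move=> [P0 PD] Pad [D DP]; have /asboolP := DP => sD.
suff: lspan (range (fun t : A * A => ad t.1 t.2)) `<=`
    [set D : gl A | exists DP, P (@Inner D DP)].
  by case/(_ _ sD) => DP'; rewrite (bool_irrelevance DP DP').
apply: lspan_ind => [|_ [[x y] _ <-]]; last by eexists; exact: Pad.
have [I0 ID] := inner_submod_closed.
split=> [|a u v [uP Pu] [vP Pv]].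
  by exists I0; rewrite [Inner _](_ : _ = 0) //; exact/val_inj.
exists (ID a u v uP vP).
rewrite [Inner _](_ : _ = a *: Inner uP + Inner vP); first exact: PD.
exact/val_inj.
Qed.

Lemma inner_derivation (D : inner) a b c :
  D (br a b c) = br (D a) b c + br a (D b) c + br a b (D c).
Proof.
move: D a b c; apply: (@innerP [set D : inner | forall a b c,
  D (br a b c) = br (D a) b c + br a (D b) c + br a b (D c)]); last first.
  by move=> x y a b c; exact: br_filippov.
split=> [|k D E HD HE] a b c.
  rewrite !inner0E (linear_at0 (br_linear1 b c)) (linear_at0 (br_linear2 a c)).
  by rewrite (linear_at0 (br_linear3 a b)) !addr0.
rewrite !innerDE !innerZE HD HE br_linear1 br_linear2 br_linear3 !scalerDr !addrA.
by rewrite [LHS](ACl (1*4*2*5*3*6)).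
Qed.

Lemma inner_lie_subproof (D E : inner) :
  lie (inner_val D) (inner_val E) \in inner_pred.
Proof.
move: E; apply: (@innerP [set E : inner |
  lie (inner_val D) (inner_val E) \in inner_pred]).
  split=> [|a u v /= uP vP].
    by rewrite /= (linear_at0 (lie_linearr _)) rpred0.
  by rewrite [lie _ _](lie_linearr (inner_val D)) rpredD // rpredZ.
move=> x y /=; rewrite lie_ad; last exact: inner_derivation.
by rewrite rpredD // inner_ad_subproof.
Qed.

Definition inner_lie (D E : inner) : inner := Inner (inner_lie_subproof D E).

Lemma inner_lie_linearl E : linear (inner_lie^~ E).
Proof. by move=> a u v; apply/val_inj; exact: (lie_linearl (val E)). Qed.

Lemma inner_lie_linearr D : linear (inner_lie D).
Proof. by move=> a u v; apply/val_inj; exact: (lie_linearr (val D)). Qed.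

Lemma inner_liexx D : inner_lie D D = 0.
Proof. by apply/val_inj; exact: liexx. Qed.

Lemma inner_lie_jacobi D1 D2 D3 : inner_lie D1 (inner_lie D2 D3) +
  inner_lie D2 (inner_lie D3 D1) + inner_lie D3 (inner_lie D1 D2) = 0.
Proof. by apply/val_inj; exact: lie_jacobi. Qed.

HB.instance Definition _ := Lmodule_isLie.Build F inner
  inner_lie_linearl inner_lie_linearr inner_liexx inner_lie_jacobi.

End Inner.

Arguments inner_ad {F A} x y.

Section Representation.
Context {F : fieldType} {L : lieType F} {V : lmodType F}.
Implicit Type rho : {linear L -> gl V}.

Definition lie_module rho : Prop :=
  forall x y, rho (lie x y) = lie (rho x) (rho y).

Definition submodule rho (W : set V) : Prop :=
  subspace W /\ forall x v, W v -> W (rho x v).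

Definition trivial_submodule rho (W : set V) : Prop :=
  submodule rho W /\ forall x v, W v -> rho x v = 0.

(* [W] is itself meant to be a submodule; its submodules are those of the
   ambient module that are included in [W]. *)
Definition irreducible rho (W : set V) : Prop :=
  forall W', submodule rho W' -> W' `<=` W -> W' = [set 0] \/ W' = W.

(* The whole module is [W = setT]. *)
Definition reducible rho (W : set V) : Prop := ~ irreducible rho W.

End Representation.

Section LinearExtension.
Context {F : fieldType} {K : choiceType} {W : lmodType F}.
Implicit Types (f : K -> W) (x : {malg F[K]}).

Definition linext f x : W := \sum_(k <- msupp x) x@_k *: f k.

Lemma linextEw f x (d : {fset K}) : (msupp x `<=` d)%fset ->
  linext f x = \sum_(k <- d) x@_k *: f k.
Proof.
move=> xd; apply: (big_fset_incl _ xd) => k _ /mcoeff_outdom ->.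
by rewrite scale0r.
Qed.

Lemma linext_linear f : linear (linext f).
Proof.
move=> a x y; pose d := (msupp x `|` msupp y `|` msupp (a *: x + y))%fset.
have [dx [dy dz]] : (msupp x `<=` d)%fset /\ (msupp y `<=` d)%fset /\
    (msupp (a *: x + y) `<=` d)%fset.
  by rewrite /d -fsetUA fsubsetUl fsetUCA fsubsetUl fsetUA fsubsetUr.
rewrite (linextEw _ dx) (linextEw _ dy) (linextEw _ dz) scaler_sumr -big_split.
by apply: eq_bigr => k _; rewrite mcoeffD mcoeffZ scalerDl scalerA.
Qed.

Lemma linextU f k : linext f << k >> = f k.
Proof.
by rewrite (linextEw _ msuppU_le) big_seq_fset1 mcoeffUU scale1r.
Qed.

Lemma linext_eq (g h : {malg F[K]} -> W) :
  linear g -> linear h -> (forall k, g << k >> = h << k >>) -> g =1 h.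
Proof.
move=> gl hl gh x.
have linsum (u : {malg F[K]} -> W) : linear u ->
    u x = \sum_(k <- msupp x) x@_k *: u << k >>.
  move=> ul; have u0 := linear_at0 ul; rewrite {1}[x]monalgE.
  elim/big_rec2: _ => [//|k a b _ <-].
  rewrite [<< x@_k *g k >>](_ : _ = x@_k *: << k >>) ?ul //.
  by apply/malgP => i; rewrite mcoeffZ !mcoeffU mulrnAr mulr1.
by rewrite (linsum g) // (linsum h) //; apply: eq_bigr => k _; rewrite gh.
Qed.

Lemma linext_eq0 (g : {malg F[K]} -> W) :
  linear g -> (forall k, g << k >> = 0) -> forall x, g x = 0.
Proof.
move=> gl g0; apply: (@linext_eq g (fun=> 0)) => // a x y.
by rewrite scaler0 addr0.
Qed.

Lemma linext_linearf a f g x :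
  linext (fun k => a *: f k + g k) x = a *: linext f x + linext g x.
Proof.
rewrite /linext scaler_sumr -big_split; apply: eq_bigr => k _ /=.
by rewrite scalerDr !scalerA mulrC.
Qed.

End LinearExtension.

(* Stated for an arbitrary operation [b]: rewriting with the concrete bracket
   triggers costly conversions. *)
Lemma filippov_basis (F : fieldType) (W : lmodType F) (b : W -> W -> W -> W)
    (L M : int -> W) :
  (forall y z, b 0 y z = 0) -> (forall y z, b y 0 z = 0) ->
  (forall y z, b y z 0 = 0) -> 
  (forall c x y z, b (c *: x) y z = c *: b x y z) ->
  (forall c x y z, b y (c *: x) z = c *: b y x z) ->
  (forall c x y z, b y z (c *: x) = c *: b y z x) ->
  (forall r s t, b (L r) (L s) (L t) = 0) -> 
  (forall r s t, b (L r) (L s) (M t) = (s - r)%:~R *: L (r + s - t)) -> 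
  (forall r s t, b (L r) (M t) (L s) = (r - s)%:~R *: L (r + s - t)) -> 
  (forall r s t, b (M t) (L r) (L s) = (s - r)%:~R *: L (r + s - t)) -> 
  (forall r s t, b (L r) (M s) (M t) = (t - s)%:~R *: M (s + t - r)) -> 
  (forall r s t, b (M s) (L r) (M t) = (s - t)%:~R *: M (s + t - r)) -> 
  (forall r s t, b (M s) (M t) (L r) = (t - s)%:~R *: M (s + t - r)) -> 
  (forall r s t, b (M r) (M s) (M t) = 0) -> 
  forall i j k l m, let v (i : int + int) := match i with inl r => L r | inr r => M r end in
  b (v i) (v j) (b (v k) (v l) (v m)) - (b (b (v i) (v j) (v k)) (v l) (v m) +
    b (v k) (b (v i) (v j) (v l)) (v m) + b (v k) (v l) (b (v i) (v j) (v m)))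
  = 0.
Proof.
move=> z1 z2 z3 s1 s2 s3 e1 e2 e3 e4 e5 e6 e7 e8 i j k l m /=.
case: i j k l m => [i|i] [j|j] [k|k] [l|l] [m|m].
all: do ?rewrite ?(z1, z2, z3, s1, s2, s3, e1, e2, e3, e4, e5, e6, e7, e8)
  ?scaler0 ?addr0 ?add0r ?subr0 //.
all: rewrite ?scalerA ?oppr0 //.
all: repeat match goal with f : int -> _ |- context [ _ *: ?f ?u ] =>
   match goal with |- context [ _ *: f ?w ] =>
     tryif constr_eq u w then fail else
     (rewrite [w](_ : w = u); last by ring) end end.
all: rewrite -?scalerDl -?scalerBl -?scaleNr.
all: by rewrite [X in X *: _](_ : _ = 0) ?scale0r //; ring.
Qed.

Lemma filippov_ext (F : fieldType) (K : choiceType)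
    (W := {malg F[K]} : lmodType F) (b : W -> W -> W -> W) :
  (forall y z, linear (fun x => b x y z)) ->
  (forall x z, linear (fun y => b x y z)) ->
  (forall x y, linear (fun z => b x y z)) ->
  (forall i j k l m : K,
    b << i >> << j >> (b << k >> << l >> << m >>) -
    (b (b << i >> << j >> << k >>) << l >> << m >> +
     b << k >> (b << i >> << j >> << l >>) << m >> +
     b << k >> << l >> (b << i >> << j >> << m >>)) = 0) ->
  forall x y a1 a2 a3, b x y (b a1 a2 a3) =
    b (b x y a1) a2 a3 + b a1 (b x y a2) a3 + b a1 a2 (b x y a3).
Proof.
move=> b1 b2 b3 bU x y a1 a2 a3; apply/eqP; rewrite -subr_eq0; apply/eqP.
have comb4 (k : F) (p q r s p' q' r' s' : W) :
    k *: p + p' - (k *: q + q' + (k *: r + r') + (k *: s + s')) =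
    k *: (p - (q + r + s)) + (p' - (q' + r' + s')).
  rewrite scalerBr !scalerDr !opprD !addrA.
  by rewrite [LHS](ACl (1*3*5*7*2*4*6*8)).
move: x; apply: linext_eq0 => [k u v|i].
  by rewrite !(b1, b2, b3) comb4.
move: y; apply: linext_eq0 => [k u v|j].
  by rewrite !(b1, b2, b3) comb4.
move: a1; apply: linext_eq0 => [k' u v|k].
  by rewrite !(b1, b2, b3) comb4.
move: a2; apply: linext_eq0 => [k' u v|l].
  by rewrite !(b1, b2, b3) comb4.
move: a3; apply: linext_eq0 => [k' u v|m].
  by rewrite !(b1, b2, b3) comb4.
exact: bU.
Qed.

Section AOmega.
Variable F : fieldType.

Definition Aomega := {malg F[(int + int)%type]}.
HB.instance Definition _ := GRing.Lmodule.on Aomega.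

Definition Lb (r : int) : Aomega := << inl r >>.
Definition Mb (r : int) : Aomega := << inr r >>.

(* The eight cases are the skew-symmetric completion of the two defining
   families [L_r, L_s, M_t] and [L_r, M_s, M_t]. *)
Definition br_basis (i j k : int + int) : Aomega :=
  match i, j, k with
  | inl r, inl s, inr t => (s - r)%:~R *: Lb (r + s - t)
  | inl r, inr t, inl s => - ((s - r)%:~R *: Lb (r + s - t))
  | inr t, inl r, inl s => (s - r)%:~R *: Lb (r + s - t)
  | inl r, inr s, inr t => (t - s)%:~R *: Mb (s + t - r)
  | inr s, inl r, inr t => - ((t - s)%:~R *: Mb (s + t - r))
  | inr s, inr t, inl r => (t - s)%:~R *: Mb (s + t - r)
  | inl _, inl _, inl _ | inr _, inr _, inr _ => 0
  end.

Definition br_omega (x y z : Aomega) : Aomega :=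
  linext (fun i => linext (fun j => linext (br_basis i j) z) y) x.

Lemma br_omega_linear1 y z : linear (fun x => br_omega x y z).
Proof. exact: linext_linear. Qed.

Lemma br_omega_linear2 x z : linear (fun y => br_omega x y z).
Proof.
move=> a u v; rewrite /br_omega -linext_linearf; congr linext.
by apply/funext => i; rewrite linext_linear.
Qed.

Lemma br_omega_linear3 x y : linear (fun z => br_omega x y z).
Proof.
move=> a u v; rewrite /br_omega -linext_linearf; congr linext.
apply/funext => i; rewrite -linext_linearf; congr linext.
by apply/funext => j; rewrite linext_linear.
Qed.

Lemma br_omegaU i j k :
  br_omega << i >> << j >> << k >> = br_basis i j k.
Proof. by rewrite /br_omega !linextU. Qed.

Lemma opp_linear (f : Aomega -> Aomega) : linear f -> linear (fun x => - f x).
Proof. by move=> fl a u v; rewrite fl opprD scalerN. Qed.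

Lemma br_omega_skew12 x y z : br_omega y x z = - br_omega x y z.
Proof.
move: x; apply: linext_eq => [||i]; [exact: br_omega_linear2| |].
  exact/opp_linear/br_omega_linear1.
move: y; apply: linext_eq => [||j]; [exact: br_omega_linear1| |].
  exact/opp_linear/br_omega_linear2.
move: z; apply: linext_eq => [||k]; [exact: br_omega_linear3| |].
  exact/opp_linear/br_omega_linear3.
rewrite !br_omegaU; case: i j k => [r|r] [s|s] [t|t] /=;
  rewrite ?opprK ?oppr0 // -scaleNr -rmorphN opprB [s + r]addrC //.
Qed.

Lemma br_omega_skew23 x y z : br_omega x z y = - br_omega x y z.
Proof.
move: x; apply: linext_eq => [||i]; [exact: br_omega_linear1| |].
  exact/opp_linear/br_omega_linear1.
move: y; apply: linext_eq => [||j]; [exact: br_omega_linear3| |].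
  exact/opp_linear/br_omega_linear2.
move: z; apply: linext_eq => [||k]; [exact: br_omega_linear2| |].
  exact/opp_linear/br_omega_linear3.
rewrite !br_omegaU; case: i j k => [r|r] [s|s] [t|t] /=;
  rewrite ?opprK ?oppr0 // -scaleNr -rmorphN opprB [t + s]addrC //.
Qed.

Lemma br_omega_filippovU (i j k l m : int + int) :
  br_omega << i >> << j >> (br_omega << k >> << l >> << m >>) -
  (br_omega (br_omega << i >> << j >> << k >>) << l >> << m >> +
   br_omega << k >> (br_omega << i >> << j >> << l >>) << m >> +
   br_omega << k >> << l >> (br_omega << i >> << j >> << m >>)) = 0.
Proof.
have z1 y z : br_omega 0 y z = 0 := linear_at0 (br_omega_linear1 y z).
have z2 y z : br_omega y 0 z = 0 := linear_at0 (br_omega_linear2 y z).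
have z3 y z : br_omega y z 0 = 0 := linear_at0 (br_omega_linear3 y z).
have s1 c x y z : br_omega (c *: x) y z = c *: br_omega x y z.
  by have := br_omega_linear1 y z c x 0; rewrite z1 !addr0.
have s2 c x y z : br_omega y (c *: x) z = c *: br_omega y x z.
  by have := br_omega_linear2 y z c x 0; rewrite z2 !addr0.
have s3 c x y z : br_omega y z (c *: x) = c *: br_omega y z x.
  by have := br_omega_linear3 y z c x 0; rewrite z3 !addr0.
have e1 r s t : br_omega (Lb r) (Lb s) (Lb t) = 0 by rewrite br_omegaU.
have e2 r s t : br_omega (Lb r) (Lb s) (Mb t) = (s - r)%:~R *: Lb (r + s - t).
  by rewrite br_omegaU.
have e3 r s t : br_omega (Lb r) (Mb t) (Lb s) = (r - s)%:~R *: Lb (r + s - t).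
  by rewrite br_omegaU /= -scaleNr -rmorphN opprB.
have e4 r s t : br_omega (Mb t) (Lb r) (Lb s) = (s - r)%:~R *: Lb (r + s - t).
  by rewrite br_omegaU.
have e5 r s t : br_omega (Lb r) (Mb s) (Mb t) = (t - s)%:~R *: Mb (s + t - r).
  by rewrite br_omegaU.
have e6 r s t : br_omega (Mb s) (Lb r) (Mb t) = (s - t)%:~R *: Mb (s + t - r).
  by rewrite br_omegaU /= -scaleNr -rmorphN opprB.
have e7 r s t : br_omega (Mb s) (Mb t) (Lb r) = (t - s)%:~R *: Mb (s + t - r).
  by rewrite br_omegaU.
have e8 r s t : br_omega (Mb r) (Mb s) (Mb t) = 0 by rewrite br_omegaU.
have bL r : << inl r >> = Lb r by [].
have bM r : << inr r >> = Mb r by [].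
have := filippov_basis z1 z2 z3 s1 s2 s3 e1 e2 e3 e4 e5 e6 e7 e8 i j k l m.
by case: i => i; case: j => j; case: k => k; case: l => l; case: m => m.
Qed.

Lemma br_omega_filippov x y a b c : br_omega x y (br_omega a b c) =
  br_omega (br_omega x y a) b c + br_omega a (br_omega x y b) c +
  br_omega a b (br_omega x y c).
Proof.
exact: (filippov_ext br_omega_linear1 br_omega_linear2 br_omega_linear3
  br_omega_filippovU).
Qed.

HB.instance Definition _ := Lmodule_isLie3.Build F Aomega
  br_omega_linear1 br_omega_linear2 br_omega_linear3
  br_omega_skew12 br_omega_skew23 br_omega_filippov.

Implicit Types r s t : int.

Lemma br_LLL r s t : br (Lb r) (Lb s) (Lb t) = 0.
Proof. exact: br_omegaU. Qed.

Lemma br_LLM r s t : br (Lb r) (Lb s) (Mb t) = (s - r)%:~R *: Lb (r + s - t).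
Proof. exact: br_omegaU. Qed.

Lemma br_LMM r s t : br (Lb r) (Mb s) (Mb t) = (t - s)%:~R *: Mb (s + t - r).
Proof. exact: br_omegaU. Qed.

Lemma br_MMM r s t : br (Mb r) (Mb s) (Mb t) = 0.
Proof. exact: br_omegaU. Qed.

Definition p_ r : inner Aomega :=
  if r == 0 then inner_ad (Lb 0) (Mb 0)
  else 2^-1 *: (inner_ad (Lb 0) (Mb (- r)) + inner_ad (Lb r) (Mb 0)).

Definition q_ r : inner Aomega :=
  if r == 0 then inner_ad (Lb 0) (Mb 0) - inner_ad (Lb 1) (Mb 1)
  else r%:~R^-1 *: (inner_ad (Lb 0) (Mb (- r)) - inner_ad (Lb r) (Mb 0)).

Definition x_ r : inner Aomega :=
  if r == 0 then 2^-1 *: inner_ad (Lb 1) (Lb (- 1))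
  else r%:~R^-1 *: inner_ad (Lb r) (Lb 0).

Definition z_ r : inner Aomega :=
  if r == 0 then 2^-1 *: inner_ad (Mb 1) (Mb (- 1))
  else (- r)%:~R^-1 *: inner_ad (Mb (- r)) (Mb 0).

Lemma inner_ad_LM_L a b s :
  inner_ad (Lb a) (Mb b) (Lb s) = (a - s)%:~R *: Lb (a + s - b).
Proof. by rewrite /= br_skew23 br_LLM -scaleNr -rmorphN opprB. Qed.

Lemma inner_ad_LM_M a b t :
  inner_ad (Lb a) (Mb b) (Mb t) = (t - b)%:~R *: Mb (b + t - a).
Proof. exact: br_LMM. Qed.

Lemma inner_ad_MM_L a b s :
  inner_ad (Mb a) (Mb b) (Lb s) = (b - a)%:~R *: Mb (a + b - s).
Proof. by rewrite /= br_skew23 br_skew12 opprK br_LMM. Qed.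

Lemma inner_ext (D E : inner Aomega) :
  (forall s, D (Lb s) = E (Lb s)) -> (forall t, D (Mb t) = E (Mb t)) -> D = E.
Proof.
move=> DL DM; apply/val_inj/glP; apply: linext_eq; try exact: gl_linear.
by case=> k; [exact: DL | exact: DM].
Qed.

Definition V_ := {malg F[F]}.
HB.instance Definition _ := GRing.Lmodule.on V_.

Definition v_ (alpha : F) : V_ := << alpha >>.

Definition U_ (alpha : F) : set V_ :=
  lspan [set v_ (alpha + m%:~R) | m in [set: int]].

Definition U'_ (alpha : F) : set V_ :=
  lspan [set v_ (alpha + m%:~R) | m in [set m : int | m != 0]].

(* The values of psi_(lambda, mu) on the spanning family p_r, q_r, x_r, z_r;
   [psi_unique] and [psi_exists] below show that, in characteristic 0, they
   determine exactly one linear map. *)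
Definition psi_spec (lambda mu : F) (psi : {linear inner Aomega -> gl V_}) :
    Prop :=
  forall (r : int) (alpha : F),
  [/\ psi (p_ r) (v_ alpha) =
        (lambda + alpha - r%:~R * mu) *: v_ (alpha - r%:~R),
      psi (q_ r) (v_ alpha) = 0,
      psi (x_ r) (v_ alpha) = 0 &
      psi (z_ r) (v_ alpha) = 0].

End AOmega.

Section InnerBasis.
Variable F : fieldType.
Hypothesis charF : [pchar F] =i pred0.
Implicit Types r s t : int.

Lemma intr_eq0_char0 r : (r%:~R == 0 :> F) = (r == 0).
Proof.
have natE n : (n%:R == 0 :> F) = (n == 0)%N by apply: ((pcharf0P F).1 charF).
case: r => n; first exact: natE.
by rewrite NegzE rmorphN oppr_eq0 -[LHS]/(n.+1%:R == 0) natE.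
Qed.

Let two_neq0 : (2 : F) != 0. Proof. by rewrite ((pcharf0P F).1 charF 2). Qed.

Let innerE := (@innerDE F, @innerNE F, @innerZE F).

Lemma p_L r s : p_ F r (Lb F s) = (r%:~R / 2 - s%:~R) *: Lb F (r + s).
Proof.
rewrite /p_; case: eqVneq => [->|r0].
  by rewrite inner_ad_LM_L mul0r !add0r subr0 rmorphN.
rewrite !innerE !inner_ad_LM_L opprK !subr0 !add0r [s + r]addrC -scalerDl scalerA.
by congr (_ *: _); field.
Qed.

Lemma p_M r t : p_ F r (Mb F t) = (r%:~R / 2 + t%:~R) *: Mb F (t - r).
Proof.
rewrite /p_; case: eqVneq => [->|r0].
  by rewrite inner_ad_LM_M mul0r !add0r !subr0.
rewrite !innerE !inner_ad_LM_M opprK !subr0 !add0r [- r + t]addrC -scalerDl.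
by rewrite scalerA; congr (_ *: _); field.
Qed.

Lemma q_L r s : q_ F r (Lb F s) = - Lb F (r + s).
Proof.
rewrite /q_; case: eqVneq => [->|r0].
  rewrite !innerE !inner_ad_LM_L subr0 [1 + s]addrC addrK !add0r -scalerBl.
  by rewrite -scaleN1r; congr (_ *: _); ring.
rewrite !innerE !inner_ad_LM_L opprK !subr0 !add0r [s + r]addrC -scalerBl scalerA.
rewrite -scaleN1r; congr (_ *: _).
by have := intr_eq0_char0 r; rewrite (negPf r0) => /negbT r'; field.
Qed.

Lemma q_M r t : q_ F r (Mb F t) = Mb F (t - r).
Proof.
rewrite /q_; case: eqVneq => [->|r0].
  rewrite !innerE !inner_ad_LM_M subr0 [1 + t]addrC addrK !add0r subr0.
  by rewrite -scalerBl -[RHS]scale1r; congr (_ *: _); ring.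
rewrite !innerE !inner_ad_LM_M opprK !subr0 !add0r [- r + t]addrC -scalerBl.
rewrite scalerA -[RHS]scale1r; congr (_ *: _).
by have := intr_eq0_char0 r; rewrite (negPf r0) => /negbT r'; field.
Qed.

Lemma x_L r s : x_ F r (Lb F s) = 0.
Proof.
by rewrite /x_; case: ifP => _; rewrite !innerE /= br_LLL scaler0.
Qed.

Lemma x_M r t : x_ F r (Mb F t) = - Lb F (r - t).
Proof.
rewrite /x_; case: eqVneq => [->|r0]; rewrite innerE /= br_LLM scalerA.
  by rewrite -scaleN1r subrr; congr (_ *: _); field.
rewrite addr0 -scaleN1r; congr (_ *: _).
by have := intr_eq0_char0 r; rewrite (negPf r0) => /negbT r'; field.
Qed.

Lemma z_L r s : z_ F r (Lb F s) = - Mb F (- r - s).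
Proof.
rewrite /z_; case: eqVneq => [->|r0]; rewrite innerE inner_ad_MM_L scalerA.
  by rewrite -scaleN1r subrr oppr0; congr (_ *: _); field.
rewrite addr0 -scaleN1r; congr (_ *: _).
by have := intr_eq0_char0 r; rewrite (negPf r0) => /negbT r'; rewrite sub0r opprK rmorphN; field; rewrite ?oppr_eq0.
Qed.

Lemma z_M r t : z_ F r (Mb F t) = 0.
Proof.
by rewrite /z_; case: ifP => _; rewrite !innerE /= br_MMM scaler0.
Qed.

Lemma inner_span (P : set (inner (Aomega F))) : subspace P ->
  (forall r, [/\ P (p_ F r), P (q_ F r), P (x_ F r) & P (z_ F r)]) ->
  forall D, P D.
Proof.
move=> sP Pg; have [P0 PD] := sP.
have PZ a D : P D -> P (a *: D) by move=> PDD; rewrite -[_ *: _]addr0; apply: PD.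
have adl (y : Aomega F) : linear (fun x => inner_ad x y : inner (Aomega F)).
  by move=> a u v; apply/val_inj/glP => w; exact: br_linear1.
have adr (x : Aomega F) : linear (fun y => inner_ad x y : inner (Aomega F)).
  by move=> a u v; apply/val_inj/glP => w; exact: br_linear2.
have Pind (g : Aomega F -> inner (Aomega F)) : linear g ->
    (forall r, P (g (Lb F r))) -> (forall r, P (g (Mb F r))) -> forall x, P (g x).
  move=> gl gL gM x; have g0 := linear_at0 gl.
  rewrite [x](monalgE (x : {malg F[(int + int)%type]})).
  elim/big_rec: _ => [|k u _ Pu]; first by rewrite g0.
  rewrite [<< _ *g k >>](_ : _ = x@_k *: << k >>); last first.
    by apply/malgP => i; rewrite mcoeffZ !mcoeffU mulrnAr mulr1.
  by rewrite [g _]gl; apply: PD => //; case: k => k; [exact: gL|exact: gM].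
have PLM a b : P (inner_ad (Lb F a) (Mb F b)).
  rewrite [inner_ad _ _](_ : _ =
      ((a - b)%:~R / 2 - a%:~R) *: q_ F (a - b) + p_ F (a - b)); last first.
    apply: inner_ext => s; rewrite !innerE.
      rewrite inner_ad_LM_L q_L p_L scalerN -scaleNr -scalerDl.
      by rewrite [a - b + s]addrAC; congr (_ *: _); ring.
    rewrite inner_ad_LM_M q_M p_M opprB addrA [s + b]addrC -scalerDl.
    by congr (_ *: _); field.
  by have [Pp Pq _ _] := Pg (a - b); exact: PD.
apply: innerP => // x y.
apply: (Pind _ (adl y)) => a; apply: (Pind _ (adr _)) => b.
- rewrite [inner_ad _ _](_ : _ = (a - b)%:~R *: x_ F (a + b)).
    by apply: PZ; have [] := Pg (a + b).
  apply: inner_ext => s; rewrite innerE ?x_L ?x_M /= ?br_LLL ?scaler0 // br_LLM.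
  by rewrite scalerN -scaleNr; congr (_ *: _); ring.
- exact: PLM.
- rewrite [inner_ad _ _](_ : _ = -1 *: inner_ad (Lb F b) (Mb F a)).
    exact: PZ.
  by apply/val_inj/glP => w; rewrite scaleN1r; exact: br_skew12.
- rewrite [inner_ad _ _](_ : _ = (a - b)%:~R *: z_ F (- a - b)).
    by apply: PZ; have [] := Pg (- a - b).
  apply: inner_ext => s; rewrite innerE ?z_L ?z_M /= ?br_MMM ?scaler0 //.
  rewrite -[LHS]/(inner_ad (Mb F a) (Mb F b) (Lb F s)) inner_ad_MM_L.
  by rewrite scalerN -scaleNr opprB opprK [b + a]addrC; congr (_ *: _); ring.
Qed.

Variables lambda mu : F.

Lemma psi_unique (psi psi' : {linear inner (Aomega F) -> gl (V_ F)}) :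
  psi_spec lambda mu psi -> psi_spec lambda mu psi' -> psi =1 psi'.
Proof.
move=> h h'; apply: (@inner_span [set D | psi D = psi' D]).
  split=> [|a D E /= HD HE]; first by rewrite /= !linear0.
  by rewrite (linearP psi) (linearP psi') HD HE.
move=> r; split; apply/glP; apply: linext_eq; try exact: gl_linear;
  by move=> k; have [e1 e2 e3 e4] := h r k; have [e1' e2' e3' e4'] := h' r k;
     rewrite -/(v_ k) ?(e1, e2, e3, e4) ?(e1', e2', e3', e4').
Qed.

(* The coefficient of p_r in an inner derivation D is the difference of the
   coefficient of L_r in D L_0 and that of L_(r+1) in D L_1. *)
Let c (alpha : F) r : V_ F := (lambda + alpha - r%:~R * mu) *: v_ (alpha - r%:~R).
Let c0 alpha (i : int + int) := if i is inl r then c alpha r else 0.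
Let c1 alpha (i : int + int) := if i is inl r then c alpha (r - 1) else 0.
Let psi0 (D : inner (Aomega F)) (v : V_ F) : V_ F :=
  linext (fun alpha =>
    linext (c0 alpha) (D (Lb F 0)) - linext (c1 alpha) (D (Lb F 1))) v.

Let psi0_gl D : psi0 D \in gl_pred (V_ F).
Proof. by apply/asboolP; exact: linext_linear. Qed.

Let psi1 D : gl (V_ F) := Gl (psi0_gl D).

Let psi1_linear : linear psi1.
Proof.
move=> a D E; apply: glP => v; apply: etrans (linext_linearf _ _ _ _).
congr linext; apply/funext => k; rewrite !innerE.
by rewrite !linext_linear scalerBr opprD addrACA.
Qed.

HB.instance Definition _ := GRing.isLinear.Build F _ _ *:%R psi1 psi1_linear.

Lemma psi_exists :
  exists psi : {linear inner (Aomega F) -> gl (V_ F)}, psi_spec lambda mu psi.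
Proof.
exists psi1 => r a.
have Z k x f : linext f (k *: x) = k *: linext f x :> V_ F.
  have := linext_linear f k x 0.
  by rewrite (linear_at0 (linext_linear f)) !addr0.
have N x f : linext f (- x) = - linext f x :> V_ F.
  by rewrite -[- x]scaleN1r Z scaleN1r.
have E D : psi1 D (v_ a) =
    linext (c0 a) (D (Lb F 0)) - linext (c1 a) (D (Lb F 1)).
  by rewrite /= /psi0 linextU.
split; rewrite E.
- rewrite p_L p_L !Z !linextU /= addr0 addrK -scalerBl -[RHS]scale1r.
  by congr (_ *: _); ring.
- by rewrite q_L q_L !N !linextU /= addr0 addrK subrr.
- by rewrite x_L x_L !(linear_at0 (linext_linear _)) subrr.
- by rewrite z_L z_L !N !linextU oppr0 subrr.
Qed.

End InnerBasis.

(* Main.v *)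
Require Import Defs.
From mathcomp Require Import all_boot all_order all_algebra.
From mathcomp Require Import boolp classical_sets functions.
From mathcomp Require Import finmap ring zify.
From mathcomp.multinomials Require Import monalg.

Set Implicit Arguments.
Unset Strict Implicit.
Unset Printing Implicit Defensive.

Import GRing.Theory.

Local Open Scope classical_set_scope.
Local Open Scope ring_scope.

(** Index the vectors of U(-lambda) as w_m = v_(-lambda + m), m an integer; then
    p_r w_m = (m - r mu) w_(m - r), while q_r, x_r and z_r act as zero.  In
    characteristic 0 the integers embed in F, and everything follows from three
    observations.

    The map psi is a representation because q_r, x_r, z_r span an ideal of the
    inner derivations ([psi_lie_ideal]), on which psi vanishes, and because the
    operators psi p_r satisfy the same Witt relation
    [p_r, p_s] = (r - s) p_(r + s) as the p_r ([commutator_tensor_density]); the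
    brackets themselves are computed from the action on the L_t and M_t.

    The operator psi p_0 is diagonal in the basis v_k, with eigenvalues
    lambda + k, so its eigenvalues are pairwise distinct and every submodule is
    spanned by the basis vectors it contains ([submodule_support]).

    Submodules are thus a matter of which basis vectors can be reached from
    which.  Sending w_m to w_n uses p_(m - n), with coefficient
    m (1 - mu) + n mu ([submodule_reach]).  If mu = 1 this is n, so every w_n
    with n nonzero is reached from everywhere, and w_0 only from itself: the w_n
    with n nonzero span an irreducible proper submodule of U(-lambda).  If
    mu = 0 the coefficient is m, so w_0 is killed.  Otherwise m (1 - mu) is
    nonzero for m nonzero, and n mu for n nonzero, so any w_m reaches any w_n by
    way of w_0, and U(-lambda) is irreducible.  The whole space is never
    irreducible: 1/2 is not an integer, so U(0) is proper. *)

(** * Lie algebras and their representations *)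

Lemma lieC (F : fieldType) (L : lieType F) (x y : L) : lie x y = - lie y x.
Proof.
have D1 (u v w : L) : lie (u + v) w = lie u w + lie v w.
  by have := lie_linearl w 1 u v; rewrite !scale1r.
have D2 (u v w : L) : lie w (u + v) = lie w u + lie w v.
  by have := lie_linearr w 1 u v; rewrite !scale1r.
have := liexx (x + y); rewrite D1 !D2 !liexx add0r addr0.
by move/eqP; rewrite addr_eq0 => /eqP.
Qed.

Lemma lie_rep_skew (F : fieldType) (L : lieType F) (V : lmodType F)
    (rho : {linear L -> gl V}) (x y : L) :
  rho (lie y x) = lie (rho y) (rho x) -> rho (lie x y) = lie (rho x) (rho y).
Proof. by move=> e; rewrite lieC linearN e -lieC. Qed.

(** Compatibility with the bracket need only be checked on spanning families:
    this handles the right argument, and [lie_rep_skew] exchanges the two. *)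
Lemma lie_rep_subspace (F : fieldType) (L : lieType F) (V : lmodType F)
    (rho : {linear L -> gl V}) (x : L) :
  subspace [set y | rho (lie x y) = lie (rho x) (rho y)].
Proof.
split=> [|a y z /= ey ez].
  rewrite /= (linear_at0 (lie_linearr x)) linear0.
  by rewrite (linear_at0 (lie_linearr _)).
by rewrite lie_linearr !linearP ey ez lie_linearr.
Qed.

Lemma lie_rep_kernel (F : fieldType) (L : lieType F) (V : lmodType F)
    (rho : {linear L -> gl V}) (x y : L) :
  rho x = 0 -> rho (lie x y) = 0 -> rho (lie x y) = lie (rho x) (rho y).
Proof. by move=> -> ->; rewrite (linear_at0 (lie_linearl _)). Qed.

(** * Brackets of the operators p_r, q_r, x_r, z_r *)

(** The brackets are computed for abstract families L and M of vectors in an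
    arbitrary module: with the concrete bases and operators, unification
    unfolds them instead of matching them syntactically. *)
Section OperatorBrackets.
Variables (F : fieldType) (W : lmodType F) (L M : int -> W).
Variables p q x z : int -> gl W.
Hypothesis two_neq0 : (2 : F) != 0.
Hypothesis pL : forall r s, p r (L s) = (r%:~R / 2 - s%:~R) *: L (r + s).
Hypothesis pM : forall r t, p r (M t) = (r%:~R / 2 + t%:~R) *: M (t - r).
Hypothesis qL : forall r s, q r (L s) = - L (r + s).
Hypothesis qM : forall r t, q r (M t) = M (t - r).
Hypothesis xL : forall r s, x r (L s) = 0.
Hypothesis xM : forall r t, x r (M t) = - L (r - t).
Hypothesis zL : forall r s, z r (L s) = - M (- r - s).
Hypothesis zM : forall r t, z r (M t) = 0.
Implicit Types r s t : int.

Definition agree (f g : gl W) :=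
  (forall t, f (L t) = g (L t)) /\ (forall t, f (M t) = g (M t)).

Let genE := (pL, pM, qL, qM, xL, xM, zL, zM).

(* In each bracket all terms are multiples of one basis vector, with indices
   that differ only by a ring identity.  [replace] is used since it matches
   syntactically, where unification would unfold the arithmetic of [int]. *)
Ltac same_index f :=
  repeat match goal with |- context [ f ?u ] =>
    match goal with |- context [ f ?w ] =>
      tryif constr_eq u w then fail else
      replace (f w) with (f u) by (congr (f _); ring) end end.

Ltac bracket := split=> t;
  rewrite commE ?glZE ?gl0E ?genE ?(linearZ, linearN, linear0) /= ?genE
    ?(scaler0, subr0, sub0r, oppr0, addr0, scalerN, opprK) ?scalerA;
  same_index L; same_index M; rewrite ?subrr //.

Ltac compare :=
  rewrite -?scaleNr -?scalerBl -?scalerDl; congr (_ *: _).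

Lemma commutator_pp r s :
  agree (commutator (p r) (p s)) ((r - s)%:~R *: p (r + s)).
Proof. by bracket; compare; field. Qed.

Lemma commutator_pq r s : agree (commutator (p r) (q s)) (- s%:~R *: q (r + s)).
Proof. by bracket; compare; ring. Qed.

Lemma commutator_px r s : agree (commutator (p r) (x s)) (- s%:~R *: x (r + s)).
Proof. by bracket; compare; field. Qed.

Lemma commutator_pz r s : agree (commutator (p r) (z s)) (- s%:~R *: z (r + s)).
Proof. by bracket; compare; field. Qed.

Lemma commutator_qq r s : agree (commutator (q r) (q s)) 0.
Proof. by bracket. Qed.

Lemma commutator_qx r s : agree (commutator (q r) (x s)) (- 2 *: x (r + s)).
Proof. by bracket; rewrite scaleNr opprK scaler_nat mulr2n. Qed.

Lemma commutator_qz r s : agree (commutator (q r) (z s)) (2 *: z (r + s)).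
Proof. by bracket; rewrite scaler_nat mulr2n opprD. Qed.

Lemma commutator_xx r s : agree (commutator (x r) (x s)) 0.
Proof. by bracket. Qed.

Lemma commutator_zz r s : agree (commutator (z r) (z s)) 0.
Proof. by bracket. Qed.

Lemma commutator_zx r s : agree (commutator (z r) (x s)) (q (r + s)).
Proof. by bracket. Qed.

End OperatorBrackets.

(** The relation of the Witt algebra for its modules of tensor densities. *)
Lemma commutator_tensor_density (F : fieldType) (W : lmodType F) (v : F -> W)
    (P : int -> gl W) (lambda mu : F) :
  (forall r k, P r (v k) = (lambda + k - r%:~R * mu) *: v (k - r%:~R)) ->
  forall r s k, commutator (P r) (P s) (v k) = ((r - s)%:~R *: P (r + s)) (v k).
Proof.
move=> Pv r s k; rewrite commE glZE !Pv !linearZ /= !Pv scalerN !scalerA.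
have -> : k - s%:~R - r%:~R = k - (r + s)%:~R by ring.
have -> : k - r%:~R - s%:~R = k - (r + s)%:~R by ring.
by rewrite -scalerBl; congr (_ *: _); ring.
Qed.

Section InnerBrackets.
Variable F : fieldType.
Hypothesis charF : [pchar F] =i pred0.
Implicit Types r s : int.

Local Notation agree := (agree (Lb F) (Mb F)).

(** An inner derivation is determined by its values on the L_t and M_t. *)
Lemma lie_inner_agree (D E G : inner (Aomega F)) :
  agree (commutator D E) G -> lie D E = G.
Proof. by case=> DL DM; apply: inner_ext. Qed.

Let two_neq0 : (2 : F) != 0. Proof. by rewrite ((pcharf0P F).1 charF 2). Qed.

Let pL := p_L charF.
Let pM := p_M charF.
Let qL := q_L charF.
Let qM := q_M charF.
Let xL := @x_L F.
Let xM := x_M charF.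
Let zL := z_L charF.
Let zM := @z_M F.

Lemma lie_pp r s : lie (p_ F r) (p_ F s) = (r - s)%:~R *: p_ F (r + s).
Proof. exact/lie_inner_agree/(commutator_pp two_neq0 pL pM). Qed.

Lemma lie_pq r s : lie (p_ F r) (q_ F s) = - s%:~R *: q_ F (r + s).
Proof. exact/lie_inner_agree/(commutator_pq pL pM qL qM). Qed.

Lemma lie_px r s : lie (p_ F r) (x_ F s) = - s%:~R *: x_ F (r + s).
Proof. exact/lie_inner_agree/(commutator_px two_neq0 pL pM xL xM). Qed.

Lemma lie_pz r s : lie (p_ F r) (z_ F s) = - s%:~R *: z_ F (r + s).
Proof. exact/lie_inner_agree/(commutator_pz two_neq0 pL pM zL zM). Qed.

Lemma lie_qq r s : lie (q_ F r) (q_ F s) = 0.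
Proof. exact/lie_inner_agree/(commutator_qq qL qM). Qed.

Lemma lie_qx r s : lie (q_ F r) (x_ F s) = - 2 *: x_ F (r + s).
Proof. exact/lie_inner_agree/(commutator_qx qL qM xL xM). Qed.

Lemma lie_qz r s : lie (q_ F r) (z_ F s) = 2 *: z_ F (r + s).
Proof. exact/lie_inner_agree/(commutator_qz qL qM zL zM). Qed.

Lemma lie_xx r s : lie (x_ F r) (x_ F s) = 0.
Proof. exact/lie_inner_agree/(commutator_xx xL xM). Qed.

Lemma lie_zz r s : lie (z_ F r) (z_ F s) = 0.
Proof. exact/lie_inner_agree/(commutator_zz zL zM). Qed.

Lemma lie_zx r s : lie (z_ F r) (x_ F s) = q_ F (r + s).
Proof. exact/lie_inner_agree/(commutator_zx qL qM xL xM zL zM). Qed.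

End InnerBrackets.

(** * Subspaces spanned by basis vectors *)

Section CoordinateSubspaces.
Variable F : fieldType.
Implicit Types (S : set F) (v w : V_ F).

Lemma lspan_vP S v : lspan (@v_ F @` S) v <-> forall k, v@_k != 0 -> S k.
Proof.
split=> [|Sv].
  move: v; apply: lspan_ind => [|_ [k Sk <-] i]; last first.
    by rewrite mcoeffU; case: (eqVneq k i) => [<- //|_]; rewrite mulr0n eqxx.
  split=> [k|a u v Su Sv k]; first by rewrite mcoeff0 eqxx.
  rewrite mcoeffD mcoeffZ; have [u0|/Su//] := eqVneq u@_k 0.
  by rewrite u0 mulr0 add0r => /Sv.
exists [seq (v@_k, v_ k) | k <- msupp v] => [_ /mapP[k kv ->]|].
  by exists k => //; apply: Sv; rewrite mcoeff_neq0.
rewrite big_map {1}[v]monalgE; apply: eq_bigr => k _.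
by apply/malgP => i; rewrite mcoeffZ !mcoeffU mulrnAr mulr1.
Qed.

Lemma lspan_v_setT : lspan (@v_ F @` setT) = setT.
Proof. by rewrite predeqE => v; split=> // _; apply/lspan_vP. Qed.

Lemma U_E alpha : U_ alpha = lspan (@v_ F @` [set alpha + m%:~R | m in setT]).
Proof. by rewrite image_comp. Qed.

Lemma U'_E alpha :
  U'_ alpha = lspan (@v_ F @` [set alpha + m%:~R | m in [set m : int | m != 0]]).
Proof. by rewrite image_comp. Qed.

End CoordinateSubspaces.

(** * The modules (V, psi) *)

Section Psi.
Variables (F : fieldType) (lambda mu : F).
Hypothesis charF : [pchar F] =i pred0.
Variable psi : {linear inner (Aomega F) -> gl (V_ F)}.
Hypothesis psiE : psi_spec lambda mu psi.
Implicit Types (r m n : int) (k : F) (S W : set (V_ F)).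

Lemma psi_p r k :
  psi (p_ F r) (v_ k) = (lambda + k - r%:~R * mu) *: v_ (k - r%:~R).
Proof. by have [] := psiE r k. Qed.

Lemma psi_qxz r : [/\ psi (q_ F r) = 0, psi (x_ F r) = 0 & psi (z_ F r) = 0].
Proof.
have ext (f : gl (V_ F)) : (forall k, f (v_ k) = 0) -> f = 0.
  by move=> f0; apply/glP/linext_eq0 => //; exact: gl_linear.
by split; apply: ext => k; have [_ eq ex ez] := psiE r k;
  [exact: eq | exact: ex | exact: ez].
Qed.

Let psi_q r := let: And3 e _ _ := psi_qxz r in e.
Let psi_x r := let: And3 _ e _ := psi_qxz r in e.
Let psi_z r := let: And3 _ _ e := psi_qxz r in e.

Lemma psi_pp r m :
  psi (lie (p_ F r) (p_ F m)) = lie (psi (p_ F r)) (psi (p_ F m)).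
Proof.
rewrite (lie_pp charF) linearZ; apply: glP.
apply: linext_eq => [||k]; try exact: gl_linear.
exact: esym (commutator_tensor_density psi_p r m k).
Qed.

(** Every bracket with one of q_r, x_r, z_r is again a combination of these,
    and psi vanishes on them. *)
Lemma psi_lie_ideal r D :
  [/\ psi (lie (q_ F r) D) = 0, psi (lie (x_ F r) D) = 0 &
      psi (lie (z_ F r) D) = 0].
Proof.
have sub E : subspace [set D | psi (lie E D) = 0].
  split=> [|a D1 D2 /= e1 e2].
    by rewrite /= (linear_at0 (lie_linearr E)) linear0.
  by rewrite lie_linearr linearP e1 e2 scaler0 addr0.
have Z a D1 : psi D1 = 0 -> psi (a *: D1) = 0.
  by rewrite linearZ /= => ->; rewrite scaler0.
have C D1 E : psi (lie E D1) = 0 -> psi (lie D1 E) = 0.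
  by rewrite lieC linearN => /eqP; rewrite oppr_eq0 => /eqP.
split; move: D; apply: (inner_span charF (sub _)) => m; split.
- by apply: C; rewrite lie_pq //; exact/Z/psi_q.
- by rewrite /= lie_qq // linear0.
- by rewrite /= lie_qx //; exact/Z/psi_x.
- by rewrite /= lie_qz //; exact/Z/psi_z.
- by apply: C; rewrite lie_px //; exact/Z/psi_x.
- by apply: C; rewrite lie_qx //; exact/Z/psi_x.
- by rewrite /= lie_xx // linear0.
- by apply: C; rewrite lie_zx //; exact: psi_q.
- by apply: C; rewrite lie_pz //; exact/Z/psi_z.
- by apply: C; rewrite lie_qz //; exact/Z/psi_z.
- by rewrite /= lie_zx //; exact: psi_q.
- by rewrite /= lie_zz // linear0.
Qed.

Lemma psi_lie_module : lie_module psi.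
Proof.
have ideal r D : [/\ psi (lie (q_ F r) D) = lie (psi (q_ F r)) (psi D),
    psi (lie (x_ F r) D) = lie (psi (x_ F r)) (psi D) &
    psi (lie (z_ F r) D) = lie (psi (z_ F r)) (psi D)].
  have [eq ex ez] := psi_lie_ideal r D.
  by split; [exact: lie_rep_kernel (psi_q r) eq
    | exact: lie_rep_kernel (psi_x r) ex | exact: lie_rep_kernel (psi_z r) ez].
move=> D E; apply: lie_rep_skew; move: D.
apply: (inner_span charF (lie_rep_subspace psi E)) => r.
have [eq ex ez] := ideal r E; split; apply: lie_rep_skew.
- move: E {eq ex ez}; apply: (inner_span charF (lie_rep_subspace psi _)) => m.
  have [eq ex ez] := ideal m (p_ F r).
  split; [exact: psi_pp | | |]; apply: lie_rep_skew.
  - exact: eq.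
  - exact: ex.
  - exact: ez.
- exact: eq.
- exact: ex.
- exact: ez.
Qed.

Lemma mcoeff_psi_p0 v k : (psi (p_ F 0) v)@_k = (lambda + k) * v@_k.
Proof.
move: v; apply: (@linext_eq F F F^o (fun v => (psi (p_ F 0) v)@_k)
  (fun v => (lambda + k) * v@_k)) => [a u v|a u v|i].
- by rewrite linearP mcoeffD mcoeffZ.
- by rewrite mcoeffD mcoeffZ mulrDr mulrCA.
rewrite -/(v_ i) psi_p mul0r !subr0 mcoeffZ mcoeffU.
by case: eqVneq => [->|]; rewrite ?mulr0n ?mulr0.
Qed.

(** The eigenvalues of psi p_0 on the basis vectors are pairwise distinct, so
    applying the product of psi p_0 - (lambda + j), over the other indices j in
    the support of v, isolates the component of v at k. *)
Lemma submodule_support W v k : submodule psi W -> W v -> v@_k != 0 -> W (v_ k).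
Proof.
move=> [[W0 WD] Wpsi] Wv vk.
pose T j w := - (lambda + j) *: w + psi (p_ F 0) w.
pose u s := foldr T v s.
have Wu s : W (u s) by elim: s => //= j s Ws; apply: WD => //; exact: Wpsi.
have coefu s i : (u s)@_i = v@_i * \prod_(j <- s) (i - j).
  elim: s => [|j s IHs] /=; first by rewrite big_nil mulr1.
  by rewrite mcoeffD mcoeffZ mcoeff_psi_p0 IHs big_cons; ring.
pose s := rem k (msupp v); pose c := (u s)@_k.
have c0 : c != 0.
  rewrite /c coefu mulf_neq0 // prodf_seq_neq0; apply/allP => j js /=.
  rewrite subr_eq0; apply: contraTneq js => <-.
  by rewrite mem_rem_uniqF ?fset_uniq.
have -> : v_ k = c^-1 *: u s.
  apply/malgP => i; rewrite mcoeffZ mcoeffU; have [<-|ki] := eqVneq k i.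
    by rewrite mulVf.
  rewrite coefu; have [->|vi] := eqVneq v@_i 0; first by rewrite mul0r mulr0.
  rewrite (big_rem i) /= ?subrr ?mul0r ?mulr0 //.
  rewrite /s (rem_filter _ (fset_uniq _)) mem_filter /= eq_sym ki.
  by rewrite -mcoeff_neq0.
by rewrite -[_ *: _]addr0; exact: WD.
Qed.

Lemma submodule_shift W r k : submodule psi W -> W (v_ k) ->
  lambda + k - r%:~R * mu != 0 -> W (v_ (k - r%:~R)).
Proof.
move=> [[W0 WD] Wpsi] Wk c0; rewrite -[v_ _](scalerK c0) -psi_p -[_ *: _]addr0.
by apply: WD => //; exact: Wpsi.
Qed.

(** Only the p_r and the basis vectors need testing, since q_r, x_r and z_r act
    as zero; used both for stability and, with W = 0, for triviality. *)
Lemma psi_lspan_v (S : set F) W : subspace W ->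
  (forall r k, S k -> W (psi (p_ F r) (v_ k))) ->
  forall D v, lspan (@v_ F @` S) v -> W (psi D v).
Proof.
move=> [W0 WD] Wp D v Lv; move: D; apply: (inner_span charF) => [|r].
  split=> [|a D E WDv WEv] /=; first by rewrite linear0.
  by rewrite linearP; exact: WD.
split; last 3 first.
- by rewrite /= psi_q.
- by rewrite /= psi_x.
- by rewrite /= psi_z.
move: v Lv; apply: lspan_ind => [|_ [k Sk <-]]; last exact: Wp.
split=> [|a u w Wu Ww] /=; first by rewrite linear0.
by rewrite linearP; exact: WD.
Qed.

Lemma lspan_v_submodule (S : set F) :
  (forall r k, S k -> lambda + k - r%:~R * mu != 0 -> S (k - r%:~R)) ->
  submodule psi (lspan (@v_ F @` S)).
Proof.
move=> Sp; have [L0 LD] := lspan_subspace (@v_ F @` S).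
split=> //; apply: psi_lspan_v => // r k Sk.
rewrite psi_p; have [->|c0] := eqVneq (lambda + k - r%:~R * mu) 0.
  by rewrite scale0r.
rewrite -[_ *: _]addr0; apply: LD => //; apply: sub_lspan.
by exists (k - r%:~R) => //; exact: Sp.
Qed.

(** By [submodule_support] a nonzero submodule contains some v_k, so a span of
    basis vectors is irreducible as soon as each of them generates all. *)
Lemma irreducible_lspan_v (S : set F) :
  (forall W, submodule psi W ->
    forall k l, S k -> S l -> W (v_ k) -> W (v_ l)) ->
  irreducible psi (lspan (@v_ F @` S)).
Proof.
move=> Sconn W Wsub WS; have [Wsp _] := Wsub; have [W0 _] := Wsp.
have [Wz|] := pselect (W `<=` [set 0]).
  by left; rewrite predeqE => v; split=> [/Wz//|->].
move=> /existsNP[v /not_implyP[Wv v0]]; right.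
have [k vk] : exists k, v@_k != 0.
  apply/not_existsP => v00; apply: v0; apply/malgP => k.
  by rewrite mcoeff0; apply/eqP/negPn/negP/v00.
have Sk : S k by apply: ((lspan_vP S v).1 (WS _ Wv)).
rewrite predeqE => w; split=> [/WS//|]; move: w.
apply: lspan_ind => // _ [l Sl <-].
exact: (Sconn W Wsub k l Sk Sl (submodule_support Wsub Wv vk)).
Qed.

Lemma reducible_lspan_v (S' S : set F) k l :
  submodule psi (lspan (@v_ F @` S')) ->
  S' `<=` S -> S' k -> S l -> ~ S' l -> reducible psi (lspan (@v_ F @` S)).
Proof.
have vS T i : lspan (@v_ F @` T) (v_ i) <-> T i.
  split=> [/lspan_vP|Ti]; last by apply: sub_lspan; exists i.
  by apply; rewrite mcoeffUU oner_neq0.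
move=> S'sub S'S S'k Sl nS'l irr.
have [|e|e] := irr _ S'sub.
- by move=> v /lspan_vP vS'; apply/lspan_vP => i /vS' /S'S.
- have : lspan (@v_ F @` S') (v_ k) by apply/vS.
  rewrite e => /(congr1 (mcoeff k)) /eqP.
  by rewrite mcoeffUU mcoeff0 oner_eq0.
- by apply/nS'l/vS; rewrite e; apply/vS.
Qed.

Lemma U_submodule alpha : submodule psi (U_ alpha).
Proof.
rewrite U_E; apply: lspan_v_submodule => r _ [m _ <-] _.
by exists (m - r) => //; rewrite rmorphB addrA.
Qed.

(** U(0) is a proper submodule because 1/2 is not an integer. *)
Lemma V_reducible : reducible psi [set: V_ F].
Proof.
rewrite -lspan_v_setT.
apply: (@reducible_lspan_v [set 0 + m%:~R | m in setT] _ 0 2^-1) => //.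
- by rewrite -U_E; exact: U_submodule.
- by exists 0 => //; rewrite addr0.
move=> [m _]; rewrite add0r => e.
have two0 : (2 : F) != 0 by rewrite ((pcharf0P F).1 charF 2).
have : (m * 2 - 1)%:~R == 0 :> F by rewrite rmorphB rmorphM /= e mulVf // subrr.
by rewrite intr_eq0_char0 // subr_eq0 => /eqP; lia.
Qed.

Lemma v_trivial_submodule :
  mu = 0 -> trivial_submodule psi (lspan [set v_ (- lambda)]).
Proof.
move=> mu0; rewrite -image_set1; split.
  by apply: lspan_v_submodule => r _ ->; rewrite mu0 mulr0 subrr subr0 eqxx.
move=> D v; apply: (@psi_lspan_v _ [set 0]) => [|r _ ->].
  by split=> [//|a u w -> ->]; rewrite /= scaler0 addr0.
by rewrite /= psi_p mu0 mulr0 subrr subr0 scale0r.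
Qed.

(** The coefficient of p_(m - n), taking v_(-lambda + m) to v_(-lambda + n), is
    m - (m - n) mu, rearranged to show that mu = 0 leaves the source index and
    mu = 1 the target index. *)
Lemma submodule_reach W m n : submodule psi W -> W (v_ (- lambda + m%:~R)) ->
  m%:~R * (1 - mu) + n%:~R * mu != 0 -> W (v_ (- lambda + n%:~R)).
Proof.
move=> Wsub Wm c0; rewrite [_ + n%:~R](_ : _ = - lambda + m%:~R - (m - n)%:~R).
  apply: submodule_shift => //; apply: contra_neq c0 => <-; ring.
by ring.
Qed.

(** For mu = 1 the coefficient of a step is its target index, hence no step
    leads to v_(-lambda). *)
Lemma U'_submodule : mu = 1 -> submodule psi (U'_ (- lambda)).
Proof.
move=> mu1; rewrite U'_E; apply: lspan_v_submodule => r _ [m m0 <-].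
rewrite mu1 mulr1 addrA subrr add0r => c0; exists (m - r);
  last by rewrite rmorphB addrA.
by apply: contraNneq c0; rewrite -rmorphB /= => ->.
Qed.

Lemma U'_irreducible : mu = 1 -> irreducible psi (U'_ (- lambda)).
Proof.
move=> mu1; rewrite U'_E.
apply: irreducible_lspan_v => W Wsub _ _ [m _ <-] [n n0 <-] Wm.
apply: (submodule_reach Wsub Wm).
by rewrite mu1 subrr mulr0 add0r mulr1 intr_eq0_char0.
Qed.

(** Every basis vector of U(-lambda) reaches v_(-lambda), as 1 - mu is nonzero,
    and v_(-lambda) reaches every basis vector, as mu is nonzero. *)
Lemma U_irreducible : mu <> 1 -> mu <> 0 -> irreducible psi (U_ (- lambda)).
Proof.
move=> /eqP mu1 /eqP mu0; rewrite U_E.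
apply: irreducible_lspan_v => W Wsub _ _ [m _ <-] [n _ <-] Wm.
have W0 : W (v_ (- lambda + 0%:~R)).
  have [<-//|m0] := eqVneq m 0.
  apply: (submodule_reach Wsub Wm).
  by rewrite mul0r addr0 mulf_neq0 ?intr_eq0_char0 // subr_eq0 eq_sym.
have [->//|n0] := eqVneq n 0.
apply: (submodule_reach Wsub W0).
by rewrite mul0r add0r mulf_neq0 ?intr_eq0_char0.
Qed.

Lemma U_reducible0 : mu = 0 -> reducible psi (U_ (- lambda)).
Proof.
move=> mu0; rewrite U_E.
apply: (@reducible_lspan_v [set - lambda] _ (- lambda) (- lambda + 1)) => //.
- by rewrite image_set1; case: (v_trivial_submodule mu0).
- by move=> _ ->; exists 0; rewrite ?addr0.
- by exists 1.
by move/eqP; rewrite -subr_eq0 addrC addKr oner_eq0.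
Qed.

Lemma U_reducible1 : mu = 1 -> reducible psi (U_ (- lambda)).
Proof.
move=> mu1; rewrite U_E.
apply: (@reducible_lspan_v [set - lambda + m%:~R | m in [set m : int | m != 0]]
  _ (- lambda + 1) (- lambda)).
- by rewrite -U'_E; exact: U'_submodule.
- by move=> _ [m _ <-]; exists m.
- by exists 1.
- by exists 0; rewrite ?addr0.
move=> [m m0 /eqP]; rewrite addrC -subr_eq0 addrK intr_eq0_char0 //.
by rewrite (negPf m0).
Qed.

End Psi.

Theorem theorem3p5 (F : fieldType) (charF : [pchar F] =i pred0)
    (lambda mu : F) (psi : {linear inner (Aomega F) -> gl (V_ F)})
    (psiE : psi_spec lambda mu psi) :
  [/\ lie_module psi,
      reducible psi [set: V_ F],
      (forall alpha : F, submodule psi (U_ alpha)),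
      (mu = 0 -> trivial_submodule psi (lspan [set v_ (- lambda)])) /\
      (mu = 1 -> submodule psi (U'_ (- lambda)) /\
                 irreducible psi (U'_ (- lambda))) &
      (irreducible psi (U_ (- lambda)) <-> mu <> 1 /\ mu <> 0)].
Proof.
split.
- exact: psi_lie_module psiE.
- exact: V_reducible psiE.
- exact: U_submodule psiE.
- split=> [|mu1]; first exact: v_trivial_submodule psiE.
  by split; [exact: U'_submodule psiE mu1 | exact: U'_irreducible psiE mu1].
split=> [irr|[mu1 mu0]]; last exact: U_irreducible psiE mu1 mu0.
split=> mue; first exact: (U_reducible1 charF psiE mue irr).
exact: (U_reducible0 charF psiE mue irr).
Qed.
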